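(* Let $G$ be a connected quiver with $n$ vertices and maximal vertex degree $d_1$. If $n \geq 4 d_1^2$, then $S_k(G) \leq B_k(G)$ for all $1 \leq k \leq n$.
   Context: A quiver $G$ is a finite undirected graph with $n\ge 1$ vertices in which loops (possibly several at the same vertex) and multiple edges between distinct vertices are allowed; finite simple graphs are the special case without loops and multiple connections. $m$ is the total number of edges, where every loop and every edge of a multiple connection is counted. The Kirchhoff matrix $K$ of $G$ is the symmetric $n\times n$ matrix with $K_{ij}=-(\text{number of edges between } i \text{ and } j)$ for $i\neq j$, and $K_{ii}=$ the degree of vertex $i$, i.e. the number of edges attached to $i$, counted with multiplicity, where each loop at $i$ counts as $1$. The maximal vertex degree $d_1$ is the largest diagonal entry of $K$. The eigenvalues of $K$ are $\lambda_1\ge\lambda_2\ge\dots\ge\lambda_n$, and $S_k(G)=\sum_{j=1}^k\lambda_j$. The redundancy $r$ is the minimal number of edges whose removal leaves no multiple connections between distinct vertices; equivalently $r=\sum_{i<j}(\mathrm{sign}(K_{ij})-K_{ij})$ (multiple loops at a vertex do not count as redundant). Set $B_k(G)=m+r+k(k+1)/2$. For a finite simple graph $r=0$, so $B_k(G)=m+k(k+1)/2$. *)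

(* Defs.v *)
From mathcomp Require Import all_boot all_order all_algebra.
From mathcomp Require Import polyrcf complex.
From mathcomp Require Import reals.

Set Implicit Arguments.
Unset Strict Implicit.
Unset Printing Implicit Defensive.

Import Order.TTheory GRing.Theory Num.Theory.

Local Open Scope ring_scope.

(* Edges are unoriented: a loop at i has endpoint set [set i], and an edge
   between i != j has endpoint set [set i; j].  Distinct elements of [edge] may
   have the same endpoint set. *)
Record quiver (n : nat) := Quiver {
  edge : finType;
  ends : edge -> {set 'I_n};
  card_ends : forall e, (0 < #|ends e| <= 2)%N
}.

Section Combinatorics.

Variables (n : nat) (G : quiver n).

Definition num_edges : nat := #|edge G|.

(* For i = j this is the number of loops at i. *)
Definition multiplicity (i j : 'I_n) : nat :=
  #|[set e : edge G | ends e == [set i; j]]|.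

(* A loop at i is attached to i once, so it contributes 1, not 2. *)
Definition degree (i : 'I_n) : nat := #|[set e : edge G | i \in ends e]|.

Definition max_degree : nat := \max_(i < n) degree i.

Definition quiver_adj : rel 'I_n :=
  fun i j => [exists e : edge G, (i \in ends e) && (j \in ends e)].

Definition quiver_connected : Prop := forall i j : 'I_n, connect quiver_adj i j.

Definition no_multiple_after (A : {set edge G}) : bool :=
  [forall i : 'I_n, forall j : 'I_n,
     (i != j) ==> (#|[set e in ~: A | ends e == [set i; j]]| <= 1)%N].

Definition redundancy : nat :=
  #|[arg min_(A < [set: edge G] | no_multiple_after A) #|A|]|.

End Combinatorics.

Definition kirchhoff (R : realType) (n : nat) (G : quiver n) : 'M[R]_n :=
  \matrix_(i, j)
    if i == j then (degree G i)%:R else - (multiplicity G i j)%:R.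

(* The roots in R of the characteristic polynomial, repeated according to
   multiplicity, in nonincreasing order. *)
Definition eigenvalues (R : realType) (n : nat) (A : 'M[R]_n) : seq R :=
  let p := char_poly A in
  sort >=%R (flatten [seq nseq (mup x p) x | x <- rootsR p]).

Definition eigenvalue_sum (R : realType) (n : nat) (G : quiver n) (k : nat) : R :=
  \sum_(0 <= j < k) (eigenvalues (kirchhoff R G))`_j.

Definition brouwer_bound (R : realType) (n : nat) (G : quiver n) (k : nat) : R :=
  (num_edges G + redundancy G)%:R + (k * k.+1)%:R / 2.

Lemma no_multiple_afterT n (G : quiver n) : no_multiple_after [set: edge G].
Proof.
apply/forallP => i; apply/forallP => j; apply/implyP => _.
rewrite (_ : [set e in _ | _] = set0) ?cards0 //.
by apply/setP => e; rewrite !inE.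
Qed.

Lemma kirchhoff_sym (R : realType) n (G : quiver n) :
  (kirchhoff R G)^T = kirchhoff R G.
Proof.
apply/matrixP => i j; rewrite !mxE eq_sym.
by case: eqP => [->//|_]; rewrite /multiplicity setUC.
Qed.

Lemma kirchhoff_diag (R : realType) n (G : quiver n) (i : 'I_n) :
  kirchhoff R G i i = (degree G i)%:R.
Proof. by rewrite mxE eqxx. Qed.

Lemma char_poly_sym_split (R : realType) n (A : 'M[R]_n) : A^T = A ->
  exists s : seq R, char_poly A = \prod_(x <- s) ('X - x%:P).
Proof.
move=> symA; pose C := R[i]; pose f : {rmorphism R -> C} := real_complex R.
pose B : 'M[C]_n := map_mx f A.
have fr x : f x \is Num.real by rewrite complex_real.
have hB : B \is hermsymmx.
  apply: realsym_hermsym; last by apply/mxOverP => i j; rewrite mxE fr.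
  apply/is_hermitianmxP; rewrite expr0 scale1r map_mx_id //.
  by apply/matrixP => i j; rewrite !mxE -[in LHS]symA mxE.
have eB := orthomx_spectralP (hermitian_normalmx hB).
have dr := hermitian_spectral_diag_real hB.
exists [seq complex.Re (spectral_diag B 0 i) | i <- enum 'I_n].
apply: (map_poly_inj f).
rewrite map_char_poly -/B big_map rmorph_prod big_enum /=.
transitivity (char_poly (diag_mx (spectral_diag B))).
  rewrite {1}eB.
  have Pu := spectral_unit B.
  set P := spectralmx B in Pu *; set D := diag_mx _.
  rewrite /char_poly.
  have -> : char_poly_mx (invmx P *m D *m P) =
     map_mx polyC (invmx P) *m char_poly_mx D *m map_mx polyC P.
    rewrite /char_poly_mx mulmxBr mulmxBl -!map_mxM; congr (_ - _).
    by rewrite mul_mx_scalar -scalemxAl -map_mxM mulVmx // map_mx1 scalemx1.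
  rewrite !det_mulmx mulrAC -det_mulmx -map_mxM mulVmx //.
  by rewrite map_mx1 det1 mul1r.
rewrite char_poly_trig ?diag_mx_is_trig //; apply: eq_bigr => i _.
rewrite rmorphB /= map_polyX map_polyC /= mxE eqxx mulr1n.
congr (_ - _%:P); apply/esym/RRe_real.
exact: (mxOverP dr).
Qed.

Lemma char_poly_eigenvalues (R : realType) n (A : 'M[R]_n) : A^T = A ->
  char_poly A = \prod_(x <- eigenvalues A) ('X - x%:P).
Proof.
move=> /char_poly_sym_split [s ps]; rewrite {1}ps; apply: perm_big.
have p0 : char_poly A != 0 by apply/monic_neq0/char_poly_monic.
rewrite /eigenvalues perm_sym perm_sort; apply/allP => x _ /=; apply/eqP.
have cx : count_mem x s = mup x (char_poly A) by rewrite ps mu_prod_XsubC.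
have -> : count_mem x s =
    ((x \in rootsR (char_poly A)) * count_mem x s)%N.
  rewrite -(roots_on_rootsR p0) in_itv /= ps root_prod_XsubC.
  rewrite -has_pred1 has_count.
  by case: (count_mem x s) => [|c]; rewrite ?muln0 ?mul1n.
rewrite cx -(count_uniq_mem x (uniq_roots _ _ _)) -/(rootsR _).
elim: (rootsR _) => //= y l IHl.
rewrite count_cat IHl count_nseq mulnDl /=.
by case: eqP => [->|].
Qed.

Lemma size_eigenvalues (R : realType) n (A : 'M[R]_n) : A^T = A ->
  size (eigenvalues A) = n.
Proof.
move=> /char_poly_eigenvalues /(congr1 (size \o polyseq)) /=.
by rewrite size_char_poly size_prod_XsubC => -[].
Qed.

Lemma redundancyE n (G : quiver n) :
  redundancy G = (\sum_(i < n) \sum_(j < n | i < j)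
    (multiplicity G i j - (0 < multiplicity G i j)))%N.
Proof.
pose E (i j : 'I_n) := [set e : edge G | ends e == [set i; j]].
have neq_lt (i j : 'I_n) : (i < j)%N -> i != j.
  by rewrite -(inj_eq val_inj) neq_ltn => ->.
rewrite /redundancy; case: arg_minnP => [|A goodA minA].
  exact: no_multiple_afterT.
apply/eqP; rewrite eqn_leq; apply/andP; split.
  pose C (i j : 'I_n) := if [pick e in E i j] is Some e then E i j :\ e else set0.
  have cardC i j :
      #|C i j| = (multiplicity G i j - (0 < multiplicity G i j))%N.
    rewrite /C /multiplicity -/(E i j); case: pickP => [e eE|E0].
      by rewrite (cardsD1 e (E i j)) eE /= subn1.
    by rewrite cards0 [#|E i j|]eq_card0.
  pose A0 := \bigcup_(i < n) \bigcup_(j < n | (i < j)%N) C i j.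
  have cardU (I : finType) (P : pred I) (F : I -> {set edge G}) :
      (#|\bigcup_(i | P i) F i| <= \sum_(i | P i) #|F i|)%N.
    apply: (big_ind2 (fun (B : {set edge G}) m => (#|B| <= m)%N)) => //.
      by rewrite cards0.
    move=> B b D d Bb Dd; apply: leq_trans (leq_add Bb Dd).
    by rewrite cardsU leq_subr.
  apply: (@leq_trans #|A0|).
    apply: minA; apply/forallP => i; apply/forallP => j; apply/implyP => nij.
    wlog ij : i j nij / (i < j)%N => [hw|].
      have := nij; rewrite -(inj_eq val_inj) neq_ltn => /orP[/hw->//|ji].
      by rewrite setUC hw // eq_sym.
    rewrite -/(E i j).
    have CA : C i j \subset A0.
      by apply: subset_trans (bigcup_sup i _) => //; apply: (bigcup_sup j).
    apply/card_le1_eqP => e f; rewrite !inE => /andP[eA eE] /andP[fA fE].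
    have in_pick g : g \notin A0 -> g \in E i j -> Some g = [pick e in E i j].
      move=> gA gE; move: (contra (subsetP CA g) gA); rewrite /C.
      case: pickP => [h hE|/(_ g)]; last by rewrite gE.
      by rewrite !inE in gE *; rewrite gE andbT negbK => /eqP->.
    by apply: Some_inj; rewrite !in_pick ?inE.
  apply: leq_trans (cardU _ _ _) _; apply: leq_sum => i _.
  by apply: leq_trans (cardU _ _ _) _; apply: leq_sum => j _; rewrite cardC.
apply: (@leq_trans (\sum_(i < n) \sum_(j < n | i < j) #|A :&: E i j|)%N).
  apply: leq_sum => i _; apply: leq_sum => j ij.
  rewrite /multiplicity -/(E i j).
  have := forallP (forallP goodA i) j; rewrite neq_lt //=.
  have -> : [set e in ~: A | ends e == [set i; j]] = E i j :\: A.
    by apply/setP => e; rewrite !inE.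
  rewrite -(cardsID A (E i j)) setIC.
  by case: #|E i j :\: A| => [|[|//]] _; rewrite ?addn0 ?leq_subr // addn1 subn1.
rewrite pair_big_dep /= -sum1_card.
have -> : (\sum_(p : 'I_n * 'I_n | p.1 < p.2) #|A :&: E p.1 p.2| =
    \sum_(e in A) \sum_(p : 'I_n * 'I_n | p.1 < p.2)
      (ends e == [set p.1; p.2]))%N.
  rewrite exchange_big /=; apply: eq_bigr => p _.
  rewrite -sum1_card big_mkcond [RHS]big_mkcond /=; apply: eq_bigr => e _.
  by rewrite !inE; case: (e \in A); case: eqP.
apply: leq_sum => e _.
rewrite -big_mkcondr /= sum1_card; apply/card_le1_eqP => -[i j] [k l].
rewrite !unfold_in /= => /andP[ij /eqP->] /andP[kl /eqP eqS].
have := set21 i j; have := set22 i j; rewrite eqS !inE.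
move=> /orP[]/eqP ej /orP[]/eqP ei; subst => //.
- by rewrite ltnn in ij.
- by have := ltn_trans ij kl; rewrite ltnn.
- by rewrite ltnn in ij.
Qed.

(* Main.v *)
(* By Gershgorin every eigenvalue of K is at most 2 d, where d is the maximal
   degree, so S_k <= 2 d k.  If d > 0 then n > 1, and connectedness gives every
   vertex an edge; hence 2 m >= n >= 4 d ^ 2, and
   2 d ^ 2 + k (k + 1) / 2 - 2 d k = (k - 2 d) ^ 2 / 2 + k / 2 >= 0. *)
Require Import Defs.
From mathcomp Require Import all_boot all_order all_algebra.
From mathcomp Require Import reals.
From mathcomp Require Import zify.

Import Order.TTheory GRing.Theory Num.Theory.

Local Open Scope ring_scope.

(** Gershgorin-type estimate: take [j] with [|v 0 j|] maximal and compare the [j]-th coordinates in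
    [v *m A = a *: v]. Eigenvectors are row vectors, hence column sums. *)
Lemma eigenvalue_le_max_col_sum (R : realFieldType) n (A : 'M[R]_n) a b :
  (forall j, \sum_i `|A i j| <= b) -> eigenvalue A a -> a <= b.
Proof.
move=> colA /eigenvalueP[v vA v0].
have /rV0Pn[i0 _] := v0.
have [j _ maxj] := @arg_maxP _ _ _ i0 predT (fun i => `|v 0 i|) isT.
have vj0 : 0 < `|v 0 j|.
  rewrite lt_def normr_ge0 andbT; apply: contraNneq v0 => vj0.
  apply/eqP/rowP => i; rewrite mxE; apply/eqP; rewrite -normr_le0 -vj0.
  exact: maxj.
rewrite -(ler_pM2r vj0).
apply: (le_trans (ler_norm _)); rewrite normrM normr_id -normrM.
have -> : a * v 0 j = (v *m A) 0 j by rewrite vA mxE.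
rewrite mxE; apply: (le_trans (ler_norm_sum _ _ _)).
apply: (@le_trans _ _ (\sum_i `|A i j| * `|v 0 j|)).
  by apply: ler_sum => i _; rewrite normrM mulrC ler_wpM2l //; apply: maxj.
by rewrite -mulr_suml ler_wpM2r.
Qed.

Lemma mem_eigenvalues (R : realType) n (A : 'M[R]_n) a : A^T = A ->
  (a \in eigenvalues A) = eigenvalue A a.
Proof.
move=> symA; rewrite eigenvalue_root_char char_poly_eigenvalues //.
by rewrite root_prod_XsubC.
Qed.

(** An edge at [j] has at most one other end [i], so it is counted at most once on the left. A loop
    at [j] adds only to the degree. *)
Lemma sum_multiplicity_le_degree n (G : quiver n) (j : 'I_n) :
  (\sum_(i | i != j) multiplicity G i j <= degree G j)%N.
Proof.
rewrite /degree -sum1_card [leqRHS]big_mkcond /=.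
have -> : (\sum_(i | i != j) multiplicity G i j =
    \sum_(e : edge G) \sum_(i | i != j) (ends e == [set i; j]))%N.
  rewrite exchange_big /=; apply: eq_bigr => i _.
  rewrite /multiplicity -sum1_card big_mkcond /=; apply: eq_bigr => e _.
  by rewrite inE; case: eqP.
apply: leq_sum => e _; rewrite inE -big_mkcondr /= sum1_card.
case: ifP => [_|/negP je]; last first.
  rewrite leqn0; apply/eqP/eq_card0 => i; rewrite unfold_in /=.
  by apply/negP => /andP[_ /eqP eE]; apply: je; rewrite eE set22.
apply/card_le1_eqP => i l; rewrite !unfold_in /=.
move=> /andP[ij /eqP eE] /andP[_ /eqP]; rewrite eE => /setP/(_ i).
by rewrite !inE eqxx (negbTE ij) /= orbF => /esym/eqP.
Qed.

Lemma degree_le_max n (G : quiver n) (i : 'I_n) :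
  (degree G i <= max_degree G)%N.
Proof. exact: (leq_bigmax i). Qed.

(** In column [j] the diagonal entry is the degree of [j], and the other entries add up in absolute
    value to at most that degree. *)
Lemma eigenvalue_kirchhoff_le (R : realType) n (G : quiver n) a :
  eigenvalue (kirchhoff R G) a -> a <= (2 * max_degree G)%:R.
Proof.
apply: eigenvalue_le_max_col_sum => j.
rewrite (bigD1 j) //= kirchhoff_diag normr_nat.
have -> : \sum_(i | i != j) `|kirchhoff R G i j| =
    (\sum_(i | i != j) multiplicity G i j)%:R.
  rewrite natr_sum; apply: eq_bigr => i /negbTE ij.
  by rewrite mxE ij normrN normr_nat.
rewrite -natrD ler_nat mul2n -addnn leq_add ?degree_le_max //.
exact: leq_trans (sum_multiplicity_le_degree _ _ _) (degree_le_max _ _ _).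
Qed.

(** Double counting of incidences: an edge has at most two ends, a loop only one. *)
Lemma sum_degree_le n (G : quiver n) :
  (\sum_i degree G i <= 2 * num_edges G)%N.
Proof.
have -> : (\sum_i degree G i = \sum_(e : edge G) #|ends e|)%N.
  transitivity (\sum_i \sum_(e : edge G) (i \in ends e))%N.
    apply: eq_bigr => i _; rewrite /degree -sum1_card big_mkcond /=.
    by apply: eq_bigr => e _; rewrite inE; case: (i \in _).
  rewrite exchange_big /=; apply: eq_bigr => e _.
  by rewrite -sum1_card [RHS]big_mkcond; apply: eq_bigr => i _; case: (i \in _).
rewrite mulnC /num_edges -sum_nat_const; apply: leq_sum => e _.
by have /andP[] := card_ends e.
Qed.

(** A path from [i] to a second vertex has a first step, and this step uses an edge at [i]. *)
Lemma connected_degree_gt0 n (G : quiver n) (i : 'I_n) :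
  (1 < n)%N -> quiver_connected G -> (0 < degree G i)%N.
Proof.
move=> n_gt1 connG.
have [j ji] : exists j, j != i.
  have /card_gt0P[j] : (0 < #|predC1 i|)%N.
    by move: (cardC1 i); rewrite card_ord => ->; lia.
  by exists j.
have /connectP[[|x p] /=] := connG i j.
  by move=> _ eji; rewrite eji eqxx in ji.
move=> /andP[/existsP[e /andP[ie _]] _] _.
by apply/card_gt0P; exists e; rewrite inE.
Qed.

Lemma connected_order_le n (G : quiver n) :
  (1 < n)%N -> quiver_connected G -> (n <= 2 * num_edges G)%N.
Proof.
move=> n_gt1 connG; apply: leq_trans (sum_degree_le _ G).
rewrite -[leqLHS]card_ord -sum1_card; apply: leq_sum => i _.
exact: connected_degree_gt0.
Qed.

Lemma eigenvalue_sum_le (R : realType) n (G : quiver n) k :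
  eigenvalue_sum R G k <= (2 * max_degree G * k)%:R.
Proof.
rewrite /eigenvalue_sum big_mkord mulnC natrM mulr_natl.
rewrite -[k in leRHS]card_ord -sumr_const; apply: ler_sum => j _.
have [jn|nj] := ltnP j (size (eigenvalues (kirchhoff R G))).
  apply: eigenvalue_kirchhoff_le.
  by rewrite -mem_eigenvalues ?mem_nth //; apply: kirchhoff_sym.
(* Here [k] may exceed [n]; past the end of the list the term is the default 0. *)
by rewrite nth_default.
Qed.

Theorem theorem3 (R : realType) (n : nat) (G : quiver n)
    (n_gt0 : (0 < n)%N)
    (connG : quiver_connected G)
    (large_n : (4 * max_degree G ^ 2 <= n)%N) :
  forall k : nat, (1 <= k <= n)%N ->
    eigenvalue_sum R G k <= brouwer_bound R G k.
Proof.
move=> k _; apply: (le_trans (eigenvalue_sum_le _ _ _ _)).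
rewrite /brouwer_bound.
(* The inequality is doubled so that it lives in the natural numbers, without the denominator 2. *)
have dk : (2 * (2 * max_degree G * k) <=
    2 * (num_edges G + redundancy G) + k * k.+1)%N.
  (* For d = 0 the left side vanishes; otherwise n >= 4, so n <= 2 m is available. *)
  have [->|d_gt0] := posnP (max_degree G); first by rewrite muln0.
  have n_gt1 : (1 < n)%N by apply: leq_trans large_n; rewrite -mulnn; nia.
  have := connected_order_le _ _ n_gt1 connG.
  (* Fixing the sign of k - 2 d lets [nia] find the square (k - 2 d) ^ 2. *)
  have [kd|dk] := leqP k (2 * max_degree G); move: large_n; rewrite -mulnn; nia.
rewrite -(ler_pM2l (ltr0Sn R 1)) mulrDr mulrCA mulfV ?pnatr_eq0 // mulr1.
by rewrite -!natrM -natrD ler_nat.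
Qed.
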